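(* Let $X_{11}=\mathbb{E}[x_0x_0^{\mathsf T}]$ and $V=\mathbb{E}_{s\sim\mathcal{D}_s}[ss^{\mathsf T}]$ be the matrices defining the dLQR problem with structured initial controller state (Problem (a) of the context), and let $w_t,v_t$ be the process and measurement noises of the LQG problem (Problem (b) of the context). If $X_{11}=\mathbb{E}[w_tw_t^{\mathsf T}]$ and $V=\mathbb{E}[v_tv_t^{\mathsf T}]$, then Problems (a) and (b) are equivalent in the sense that they have the same optimal solutions $\mathsf K\in\mathbb{K}$.
   Context: Fix $A\in\mathbb{R}^{n\times n}$, $B\in\mathbb{R}^{n\times m}$, $C\in\mathbb{R}^{d\times n}$, $Q\in\mathbb{R}^{n\times n}$ symmetric positive semidefinite and $R\in\mathbb{R}^{m\times m}$ symmetric positive definite. A full-order dynamic controller is $$\xi_{t+1}=A_{\mathsf K}\xi_t+B_{\mathsf K}y_t,\quad u_t=C_{\mathsf K}\xi_t,\qquad \mathsf K=\begin{bmatrix}0_{m\times d}&C_{\mathsf K}\\ B_{\mathsf K}&A_{\mathsf K}\end{bmatrix},$$ with $A_{\mathsf K}\in\mathbb{R}^{n\times n}$, $B_{\mathsf K}\in\mathbb{R}^{n\times d}$, $C_{\mathsf K}\in\mathbb{R}^{m\times n}$. $\mathbb{K}$ is the set of such $\mathsf K$ for which the closed-loop matrix $\mathcal{A}_{\mathsf K}:=\begin{bmatrix}A&BC_{\mathsf K}\\ B_{\mathsf K}C&A_{\mathsf K}\end{bmatrix}$ has spectral radius less than $1$. Problem (a) (dLQR with $\xi_0$ a function of $\mathsf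 K$): for the deterministic system $x_{t+1}=Ax_t+Bu_t$, $y_t=Cx_t$ under the controller, minimize over $\mathsf K\in\mathbb{K}$ the cost $J(\mathsf K)=\mathbb{E}\left[\sum_{t=0}^\infty(x_t^{\mathsf T}Qx_t+u_t^{\mathsf T}Ru_t)\right]=\mathrm{Tr}(P_{\mathsf K}X)$, where $P_{\mathsf K}$ is the unique positive semidefinite solution of $P_{\mathsf K}=\begin{bmatrix}Q&0\\ 0&C_{\mathsf K}^{\mathsf T}RC_{\mathsf K}\end{bmatrix}+\mathcal{A}_{\mathsf K}^{\mathsf T}P_{\mathsf K}\mathcal{A}_{\mathsf K}$, and $X$ is the second-moment matrix of $\bar x_0=(x_0,\xi_0)$. The initial controller state is constrained to be $\xi_0=B_{\mathsf K}s$, where $s\in\mathbb{R}^d$ is drawn from a fixed distribution $\mathcal{D}_s$ with zero mean and independent of $x_0$, so that $X=\begin{bmatrix}X_{11}&0\\ 0&B_{\mathsf K}VB_{\mathsf K}^{\mathsf T}\end{bmatrix}$ with $V=\mathbb{E}[ss^{\mathsf T}]$ fixed. Problem (b) (LQG): for the stochastic system $x_{t+1}=Ax_t+Bu_t+w_t$, $y_t=Cx_t+v_t$ under the controller, minimize over $\mathsf K\in\mathbb{K}$ the average cost $\lim_{N\to\infty}\frac1N\mathbb{E}_{x_0,w_t,v_t}\left[\sum_{t=0}^{N-1}(x_t^{\mathsf T}Qx_t+u_t^{\mathsf T}Ru_t)\right]$, where $w_t\in\mathbb{R}^n$, $v_t\in\mathbb{R}^d$ are independent (zero-mean) white Gaussian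 noises with time-invariant covariances. Here the initial states are taken with finite second moments and independent of the noises. *)

(* Defs.v *)
From HB Require Import structures.
From mathcomp Require Export all_boot all_order all_algebra.
From mathcomp Require Export finmap.
From mathcomp Require Export complex.
From mathcomp Require Export all_classical all_reals all_analysis.

Set Implicit Arguments.
Unset Strict Implicit.
Unset Printing Implicit Defensive.

Import Order.TTheory GRing.Theory Num.Theory.
Import numFieldNormedType.Exports.

Local Open Scope classical_set_scope.
Local Open Scope ring_scope.

Section Matrices.
Context {F : realType}.

Definition qform k (M : 'M[F]_k) (x : 'cV[F]_k) : F := (x^T *m M *m x) 0 0.

Definition sym_psd k (M : 'M[F]_k) : Prop :=
  M^T = M /\ forall x : 'cV[F]_k, 0 <= qform M x.

Definition sym_pd k (M : 'M[F]_k) : Prop :=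
  M^T = M /\ forall x : 'cV[F]_k, x != 0 -> 0 < qform M x.

(* The supremum of a finite set of moduli, hence the maximum when k > 0; it is
   0 (the supremum of the empty set) when k = 0. *)
Definition spectral_radius k (M : 'M[F]_k) : F :=
  sup [set ComplexField.Normc.normc l
      | l in [set l : F[i] | eigenvalue (map_mx (real_complex F) M) l]].

End Matrices.

Section RandomVectors.
Context {d : measure_display} {T : measurableType d} {F : realType}.
Variable P : probability T F.

(* MathComp-Analysis has no sigma-algebra on 'cV[F]_k: a random vector is a
   vector-valued function with measurable coordinates. *)
Definition coord k (X : T -> 'cV[F]_k) (i : 'I_k) : T -> F :=
  fun omega => X omega i 0.

Definition random_vector k (X : T -> 'cV[F]_k) : Prop :=
  forall i, measurable_fun setT (coord X i).

(* Membership in Lfun includes measurability. *)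
Definition finite_second_moment k (X : T -> 'cV[F]_k) : Prop :=
  forall i, coord X i \in Lfun P 2%:E.

Definition zero_mean k (X : T -> 'cV[F]_k) : Prop :=
  forall i, ('E_P[coord X i] = 0)%E.

Definition second_moment k (X : T -> 'cV[F]_k) : 'M[F]_k :=
  \matrix_(i, j) fine 'E_P[coord X i \* coord X j].

Definition generated_sigma_algebra k (X : T -> 'cV[F]_k) : set (set T) :=
  <<s [set E | exists (i : 'I_k) (S : set F),
                 measurable S /\ E = coord X i @^-1` S] >>.

Definition independent k l (X : T -> 'cV[F]_k) (Y : T -> 'cV[F]_l) : Prop :=
  forall E E', generated_sigma_algebra X E -> generated_sigma_algebra Y E' ->
  (P (E `&` E') = P E * P E')%E.

Definition mutually_independent (I : choiceType) (G : I -> set (set T)) : Prop :=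
  forall (J : {fset I}) (E : I -> set T),
    (forall j, j \in J -> G j (E j)) ->
    P (\bigcap_(j in [set` J]) E j) = (\prod_(j <- J) P (E j))%E.

(* normal_prob is parametrized by the standard deviation, and its value at 0 is
   not the degenerate normal law. *)
Definition normal_law (mu sigma : F) : set F -> \bar F :=
  if sigma == 0 then \d_mu else normal_prob mu sigma.

(* Degenerate Gaussian vectors (singular covariance) are included. *)
Definition gaussian_vector k (X : T -> 'cV[F]_k) : Prop :=
  random_vector X /\
  forall a : 'cV[F]_k, exists mu sigma : F, forall S : set F, measurable S ->
    P [set omega | S ((a^T *m X omega) 0 0)] = normal_law mu sigma S.

(* Independence across time is part of [noises_and_init_independent]. *)
Definition gaussian_noise k (X : nat -> T -> 'cV[F]_k) (S : 'M[F]_k) : Prop :=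
  forall t, [/\ gaussian_vector (X t), zero_mean (X t) & second_moment (X t) = S].

(* Mutual independence of the family (x0, xi0), w 0, w 1, ..., v 0, v 1, ...;
   x0 and xi0 may depend on each other. *)
Definition noises_and_init_independent k l (x0 xi0 : T -> 'cV[F]_k)
    (w : nat -> T -> 'cV[F]_k) (v : nat -> T -> 'cV[F]_l) : Prop :=
  mutually_independent (fun i : option (nat + nat) =>
    match i with
    | None => generated_sigma_algebra (fun omega => col_mx (x0 omega) (xi0 omega))
    | Some (inl t) => generated_sigma_algebra (w t)
    | Some (inr t) => generated_sigma_algebra (v t)
    end).

End RandomVectors.

Section Controllers.
Context {F : realType} {n m d : nat}.
Variables (A : 'M[F]_n) (B : 'M[F]_(n, m)) (C : 'M[F]_(d, n)).
Variables (Q : 'M[F]_n) (R : 'M[F]_m).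
Implicit Types K : 'M[F]_(m + n, d + n).

Definition ctrlA K : 'M[F]_n := drsubmx K.
Definition ctrlB K : 'M[F]_(n, d) := dlsubmx K.
Definition ctrlC K : 'M[F]_(m, n) := ursubmx K.

Definition closed_loop K : 'M[F]_(n + n) :=
  block_mx A (B *m ctrlC K) (ctrlB K *m C) (ctrlA K).

Definition stabilizing : set 'M[F]_(m + n, d + n) :=
  [set K | ulsubmx K = 0 /\ spectral_radius (closed_loop K) < 1].

(* The pair (x_t, xi_t) for the noise realizations w, v. *)
Fixpoint trajectory K (w : nat -> 'cV[F]_n) (v : nat -> 'cV[F]_d)
    (x0 xi0 : 'cV[F]_n) (t : nat) : 'cV[F]_n * 'cV[F]_n :=
  if t is t'.+1 then
    let: (x, xi) := trajectory K w v x0 xi0 t' in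
    let u := ctrlC K *m xi in
    let y := C *m x + v t' in
    (A *m x + B *m u + w t', ctrlA K *m xi + ctrlB K *m y)
  else (x0, xi0).

Definition stage_cost K (z : 'cV[F]_n * 'cV[F]_n) : F :=
  qform Q z.1 + qform R (ctrlC K *m z.2).

Definition dlqr_cost dT (T : measurableType dT) (P : probability T F)
    (x0 : T -> 'cV[F]_n) (s : T -> 'cV[F]_d) K : \bar F :=
  (\int[P]_omega \sum_(0 <= t <oo)
     (stage_cost K (trajectory K (fun=> 0%R) (fun=> 0%R)
        (x0 omega) (ctrlB K *m s omega) t))%:E)%E.

Definition lqg_cost dT (T : measurableType dT) (P : probability T F)
    (x0 xi0 : T -> 'cV[F]_n)
    (w : nat -> T -> 'cV[F]_n) (v : nat -> T -> 'cV[F]_d) K : \bar F :=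
  limn (fun N : nat => (N%:R^-1)%:E *
    'E_P[fun omega => (\sum_(t < N)
       stage_cost K (trajectory K (fun k => w k omega) (fun k => v k omega)
          (x0 omega) (xi0 omega) t))%R])%E.

Definition optimal_solutions (J : 'M[F]_(m + n, d + n) -> \bar F) :
    set 'M[F]_(m + n, d + n) :=
  [set K | stabilizing K /\ forall K', stabilizing K' -> (J K <= J K')%E].

End Controllers.

(* Main.v *)
Require Import Defs.
From mathcomp Require Import ring lra measurable_realfun.
Import Order.TTheory GRing.Theory Num.Theory.
Import numFieldNormedType.Exports.
Local Open Scope classical_set_scope.
Local Open Scope ring_scope.
Set Implicit Arguments.
Unset Strict Implicit.
Unset Printing Implicit Defensive.

(** The two costs are equal on every stabilizing controller, so they have the
    same minimizers. Write L for the closed-loop matrix, M for the weight with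
    diagonal blocks Q and C_K^T R C_K, and X for the block-diagonal matrix with
    blocks X11 and B_K V B_K^T.

    In problem (a) the joint state at time t is L^t z0, and z0 has second moment
    X, because x0 and the centred s are independent. As the stage costs are
    nonnegative, expectation and infinite sum commute, and the cost is the series
    of tr (M L^t X (L^t)^T) ([dlqr_costE]).

    In problem (b) the disturbance (w_t, B_K v_t) has the same second moment X
    and is uncorrelated with the state at time t. The second moment of the state
    thus satisfies S_(t+1) = L S_t L^T + X, so the expected stage cost at time t is
    tr (M L^t S_0 (L^t)^T) plus the t-th partial sum of the series of problem (a)
    ([state_second_moment]). The first term tends to 0, and by Cesaro the averages
    of the partial sums tend to the sum of the series ([lqg_costE]).

    Both arguments need the series tr (M L^t S (L^t)^T) to converge for all M and
    S, which is where stability enters ([is_cvg_series_trace_powers]). The entries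
    of L^t are absolutely summable because the factors L - z over the eigenvalues z
    multiply to 0 by Cayley-Hamilton, and each factor can be removed at the price
    of bounding a scalar recurrence u_(t+1) = z u_t + v_t with |z| < 1 and v
    summable.

    Finite second moments of the noises have to be extracted from their Gaussian
    law ([gaussian_finite_second_moment]). *)

(** * Absolute summability of the powers of a stable matrix *)

(** Bounded partial sums are used instead of convergence because the notion is
    needed over F[i], where it makes sense with the partial order alone. *)
Definition abs_summable (K : numDomainType) (u : nat -> K) : Prop :=
  exists c : K, forall N : nat, \sum_(t < N) `|u t| <= c.

Section AbsSummable.
Context {K : numDomainType}.
Implicit Types u v : nat -> K.

Lemma eq_abs_summable u v : u =1 v -> abs_summable u -> abs_summable v.
Proof.
by move=> uv [c uc]; exists c => N; under eq_bigr do rewrite -uv.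
Qed.

Lemma abs_summable0 : abs_summable (fun=> 0 : K).
Proof. by exists 0 => N; rewrite big1// => t _; rewrite normr0. Qed.

Lemma abs_summableD u v :
  abs_summable u -> abs_summable v -> abs_summable (fun t => u t + v t).
Proof.
move=> [c uc] [e ve]; exists (c + e) => N.
apply: le_trans (lerD (uc N) (ve N)); rewrite -big_split /=.
by apply: ler_sum => t _; exact: ler_normD.
Qed.

Lemma abs_summableM u v :
  abs_summable u -> abs_summable v -> abs_summable (fun t => u t * v t).
Proof.
move=> [c uc] [e ve]; exists (c * e) => N.
have ule t : `|u t| <= c.
  by apply: le_trans (uc t.+1); rewrite big_ord_recr/= lerDr sumr_ge0.
apply: (@le_trans _ _ (\sum_(t < N) c * `|v t|)).
  by apply: ler_sum => t _; rewrite normrM ler_wpM2r.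
rewrite -mulr_sumr ler_wpM2l//.
exact: le_trans (normr_ge0 _) (ule 0%N).
Qed.

Lemma abs_summableZ (a : K) u :
  abs_summable u -> abs_summable (fun t => a * u t).
Proof.
move=> [c uc]; exists (`|a| * c) => N.
under eq_bigr do rewrite normrM.
by rewrite -mulr_sumr ler_wpM2l.
Qed.

Lemma abs_summable_sum (I : finType) (w : I -> nat -> K) :
  (forall i, abs_summable (w i)) -> abs_summable (fun t => \sum_i w i t).
Proof.
move=> wS; elim: (index_enum I) => [|i r IH].
  by apply: eq_abs_summable abs_summable0 => t; rewrite big_nil.
by apply: eq_abs_summable (abs_summableD (wS i) IH) => t; rewrite big_cons.
Qed.

End AbsSummable.

(** Summing |u (t+1)| <= |lam| |u t| + |v t| gives
    S <= |u 0| + |lam| S + c for every partial sum S, and |lam| < 1 lets the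
    middle term be absorbed. *)
Lemma abs_summable_recurrence (K : numFieldType) (lam : K) (u v : nat -> K) :
  `|lam| < 1 -> (forall t, u t.+1 = lam * u t + v t) ->
  abs_summable v -> abs_summable u.
Proof.
move=> lam1 uE [c vc]; exists ((`|u 0%N| + c) / (1 - `|lam|)) => N.
have d0 : 0 < 1 - `|lam| by rewrite subr_gt0.
rewrite ler_pdivlMr// mulrBr mulr1 lerBlDr.
apply: (@le_trans _ _ (\sum_(t < N.+1) `|u t|)).
  by rewrite big_ord_recr/= lerDl.
rewrite big_ord_recl/= -addrA lerD2l.
apply: (@le_trans _ _ (\sum_(t < N) (`|v t| + `|lam| * `|u t|))).
  apply: ler_sum => t _.
  by rewrite /bump/= add1n uE addrC (le_trans (ler_normD _ _))// normrM.
by rewrite big_split/= -mulr_sumr mulrC lerD2r vc.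
Qed.

Section PowerSummable.
Context {K : numFieldType} {k : nat}.
Implicit Types M N : 'M[K]_k.

(** Each linear factor M - z of a product can be stripped off, because
    M^(t+1) N = z M^t N + M^t (M - z) N is the recurrence of
    [abs_summable_recurrence] entry by entry. *)
Lemma abs_summable_factors M N (r : seq K) :
  {in r, forall z, `|z| < 1} ->
  (forall i j, abs_summable
     (fun t => (M ^+ t *m (\prod_(z <- r) (M - z%:M) *m N)) i j)) ->
  forall i j, abs_summable (fun t => (M ^+ t *m N) i j).
Proof.
elim: r => [|z r IH] r1 S i j.
  apply: eq_abs_summable (S i j) => t.
  by rewrite big_nil -[1]/(1%:M) mul1mx.
apply: IH => [y yr|i' j']; first by rewrite r1// inE yr orbT.
apply: (abs_summable_recurrence (r1 z (mem_head _ _)) _ (S i' j')) => t.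
set N' := \prod_(y <- r) (M - y%:M) *m N.
have -> : \prod_(y <- z :: r) (M - y%:M) *m N = (M - z%:M) *m N'.
  by rewrite big_cons; exact/esym/mulmxA.
have -> : M ^+ t.+1 *m N' = z *: (M ^+ t *m N') + M ^+ t *m ((M - z%:M) *m N').
  rewrite mulmxBl mulmxBr mul_scalar_mx -scalemxAr addrCA subrr addr0 mulmxA.
  by rewrite exprSr.
by rewrite mxE [X in X + _]mxE.
Qed.

End PowerSummable.

(** By Cayley-Hamilton the product of the factors M - z over the eigenvalues z,
    with multiplicity, vanishes; stripping these factors then leaves M^t. *)
Lemma abs_summable_powers (K : numClosedFieldType) (k : nat) (M : 'M[K]_k) :
  (forall z, eigenvalue M z -> `|z| < 1) ->
  forall i j, abs_summable (fun t => (M ^+ t) i j).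
Proof.
case: k M => [|k] M M1 i j; first by case: i.
have [r Dr] := closed_field_poly_normal (char_poly M).
have {}Dr : char_poly M = \prod_(z <- r) ('X - z%:P).
  by rewrite Dr (monicP (char_poly_monic M)) scale1r.
suff S : forall i j, abs_summable (fun t => (M ^+ t *m 1%:M) i j).
  by apply: eq_abs_summable (S i j) => t; rewrite mulmx1.
apply: (@abs_summable_factors _ _ _ _ r) => [z zr|i' j'].
  by apply: M1; rewrite eigenvalue_root_char Dr root_prod_XsubC.
suff -> : \prod_(z <- r) (M - z%:M) = 0.
  by apply: eq_abs_summable abs_summable0 => t; rewrite mul0mx mulmx0 mxE.
rewrite -(Cayley_Hamilton M) Dr rmorph_prod; apply: eq_bigr => z _.
by rewrite rmorphB/= horner_mx_X horner_mx_C.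
Qed.

Section SpectralRadius.
Context {F : realType} {k : nat}.
Implicit Types A M S : 'M[F]_k.

(** [spectral_radius] is a supremum, which dominates its set only when that set is
    bounded: here because the characteristic polynomial has finitely many
    roots. *)
Lemma eigenvalue_le_spectral_radius A (z : F[i]) :
  eigenvalue (map_mx (real_complex F) A) z ->
  ComplexField.Normc.normc z <= spectral_radius A.
Proof.
move=> Az; apply: ub_le_sup; last by exists z.
have [r Dr] := closed_field_poly_normal
  (char_poly (map_mx (real_complex F) A)).
exists (\sum_(y <- r) ComplexField.Normc.normc y) => _ [y /= Ay <-].
have yr : y \in r.
  move: Ay; rewrite eigenvalue_root_char Dr.
  by rewrite (monicP (char_poly_monic _)) scale1r root_prod_XsubC.
rewrite (big_rem y yr)/= lerDl sumr_ge0// => x _.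
by case: x => a b; exact: sqrtr_ge0.
Qed.

(** The eigenvalues are complex, so the powers of A are estimated after
    embedding A into the matrices over F[i]. *)
Lemma stable_powers_summable A :
  spectral_radius A < 1 -> forall i j, abs_summable (fun t => (A ^+ t) i j).
Proof.
move=> A1 i j.
have normE (x : F[i]) : `|x| = (ComplexField.Normc.normc x)%:C%C by [].
have [z Az|c Sc] := @abs_summable_powers _ _ (map_mx (real_complex F) A) _ i j.
  have := le_lt_trans (eigenvalue_le_spectral_radius Az) A1.
  by rewrite normE ltcR.
(* A bound on sums of real terms in the order of F[i] has a usable real part. *)
exists (complex.Re c) => N; have := Sc N.
have -> : \sum_(t < N) `|(map_mx (real_complex F) A ^+ t) i j| =
          (\sum_(t < N) `|(A ^+ t) i j|)%:C%C.
  rewrite rmorph_sum; apply: eq_bigr => t _.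
  have -> : map_mx (real_complex F) A ^+ t = map_mx (real_complex F) (A ^+ t).
    elim: (val t) => [|t' IH]; first by rewrite !expr0 -[1]/(1%:M) map_mx1.
    by rewrite !exprS IH -[_ * _ in LHS]/(_ *m _) -map_mxM.
  by rewrite mxE normE /= expr0n/= addr0 sqrtr_sqr.
by case: (c) => a b; rewrite lecE/= => /andP[].
Qed.

Lemma is_cvg_series_abs_summable (u : nat -> F) :
  abs_summable u -> cvgn (series u).
Proof.
move=> [c uc]; apply: normed_cvg; apply: nondecreasing_is_cvgn.
  by apply: nondecreasing_series => n _ _; exact: normr_ge0.
exists c => _ [N _ <-]; have := uc N.
by rewrite -(big_mkord xpredT (fun t => `|u t|)).
Qed.

(** The trace is a finite linear combination of products of two entries of
    A^t. *)
Lemma is_cvg_series_trace_powers A M S :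
  spectral_radius A < 1 ->
  cvgn (series (fun t => \tr (M *m (A ^+ t *m S *m (A ^+ t)^T)))).
Proof.
move=> /stable_powers_summable sA; apply: is_cvg_series_abs_summable.
apply: abs_summable_sum => i.
apply: (@eq_abs_summable _ (fun t => \sum_a M i a * \sum_b
   (\sum_c S c b * (A ^+ t) a c) * (A ^+ t) i b)) => [t|].
  rewrite mxE; apply: eq_bigr => a _; rewrite mxE; congr (_ * _).
  apply: eq_bigr => b _; rewrite !mxE; congr (_ * _).
  by apply: eq_bigr => c _; rewrite mulrC.
apply: abs_summable_sum => a; apply/abs_summableZ/abs_summable_sum => b.
by apply: abs_summableM => //; apply: abs_summable_sum => c; exact: abs_summableZ.
Qed.

End SpectralRadius.

(** * Mixed second moments of random vectors *)

Section SecondMoments.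
Context {dT : measure_display} {T : measurableType dT} {F : realType}.
Variable P : probability T F.

Definition cross_moment k l (X : T -> 'cV[F]_k) (Y : T -> 'cV[F]_l) :
    'M[F]_(k, l) :=
  \matrix_(i, j) fine 'E_P[coord X i \* coord Y j].

Lemma finite_second_momentD k (X Y : T -> 'cV[F]_k) :
  finite_second_moment P X -> finite_second_moment P Y ->
  finite_second_moment P (fun omega => X omega + Y omega).
Proof.
move=> hX hY i.
rewrite (_ : coord _ i = coord X i + coord Y i); last first.
  by apply/funext => omega; rewrite /coord mxE.
by rewrite rpredD ?lee1n.
Qed.

Lemma finite_second_moment_mulmx k l (D : 'M[F]_(l, k)) (X : T -> 'cV[F]_k) :
  finite_second_moment P X ->
  finite_second_moment P (fun omega => D *m X omega).
Proof.
move=> hX i.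
rewrite (_ : coord _ i = \sum_j D i j *: coord X j); last first.
  by apply/funext => omega; rewrite /coord mxE fct_sumE.
elim/big_ind: _ => [|f g fL gL|j _]; first by rewrite rpred0 ?lee1n.
  by rewrite rpredD ?lee1n.
by rewrite rpredZ ?lee1n.
Qed.

Lemma finite_second_moment_col_mx k l (X : T -> 'cV[F]_k) (Y : T -> 'cV[F]_l) :
  finite_second_moment P X -> finite_second_moment P Y ->
  finite_second_moment P (fun omega => col_mx (X omega) (Y omega)).
Proof.
move=> hX hY i; case: (split_ordP i) => j ->.
- rewrite (_ : coord _ _ = coord X j)//.
  by apply/funext => omega; rewrite /coord col_mxEu.
- rewrite (_ : coord _ _ = coord Y j)//.
  by apply/funext => omega; rewrite /coord col_mxEd.
Qed.

Let fin_num_cross k l (X : T -> 'cV[F]_k) (Y : T -> 'cV[F]_l) i j :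
  finite_second_moment P X -> finite_second_moment P Y ->
  ('E_P[coord X i \* coord Y j] \is a fin_num)%E.
Proof. by move=> hX hY; apply/expectation_fin_num/Lfun2_mul_Lfun1. Qed.

Lemma cross_moment_tr k l (X : T -> 'cV[F]_k) (Y : T -> 'cV[F]_l) :
  (cross_moment X Y)^T = cross_moment Y X.
Proof.
apply/matrixP => i j; rewrite !mxE; congr (fine 'E_P[_]).
by apply/funext => omega /=; rewrite mulrC.
Qed.

Lemma cross_momentDl k l (X Y : T -> 'cV[F]_k) (Z : T -> 'cV[F]_l) :
  finite_second_moment P X -> finite_second_moment P Y ->
  finite_second_moment P Z ->
  cross_moment (fun omega => X omega + Y omega) Z =
  cross_moment X Z + cross_moment Y Z.
Proof.
move=> hX hY hZ; apply/matrixP => i j; rewrite !mxE.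
rewrite -fineD ?fin_num_cross// -expectationD ?Lfun2_mul_Lfun1//.
congr (fine 'E_P[_]); apply/funext => omega /=.
by rewrite /coord mxE mulrDl.
Qed.

Lemma cross_moment_mulmxl k l p (D : 'M[F]_(p, k))
    (X : T -> 'cV[F]_k) (Y : T -> 'cV[F]_l) :
  finite_second_moment P X -> finite_second_moment P Y ->
  cross_moment (fun omega => D *m X omega) Y = D *m cross_moment X Y.
Proof.
move=> hX hY; apply/matrixP => i j; rewrite !mxE.
under eq_bigr => a _.
  rewrite mxE -[D i a]/(fine (D i a)%:E) -fineM ?fin_num_cross//.
  rewrite -expectationZl ?Lfun2_mul_Lfun1//; over.
rewrite sum_fine => [|a _]; last first.
  by rewrite expectationZl ?Lfun2_mul_Lfun1// fin_numM ?fin_num_cross.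
rewrite -(big_map (fun a => D i a \o* (coord X a \* coord Y j)) xpredT
  (fun f => 'E_P[f]%E)) -expectation_sum => [|f /mapP[a _ ->]]; last first.
  by apply: Lfun_scale => //; exact: Lfun2_mul_Lfun1.
congr (fine 'E_P[_]); apply/funext => omega /=.
rewrite big_map fct_sumE /coord mxE mulr_suml; apply: eq_bigr => a _ /=.
by ring.
Qed.

Lemma cross_momentDr k l (X : T -> 'cV[F]_k) (Y Z : T -> 'cV[F]_l) :
  finite_second_moment P X -> finite_second_moment P Y ->
  finite_second_moment P Z ->
  cross_moment X (fun omega => Y omega + Z omega) =
  cross_moment X Y + cross_moment X Z.
Proof.
by move=> hX hY hZ; rewrite -cross_moment_tr cross_momentDl// linearD/=
  !cross_moment_tr.
Qed.

Lemma cross_moment_mulmxr k l p (D : 'M[F]_(p, l))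
    (X : T -> 'cV[F]_k) (Y : T -> 'cV[F]_l) :
  finite_second_moment P X -> finite_second_moment P Y ->
  cross_moment X (fun omega => D *m Y omega) = cross_moment X Y *m D^T.
Proof.
by move=> hX hY; rewrite -cross_moment_tr cross_moment_mulmxl// trmx_mul
  cross_moment_tr.
Qed.

Lemma cross_moment_col_mxl k l p (X : T -> 'cV[F]_k) (Y : T -> 'cV[F]_l)
    (Z : T -> 'cV[F]_p) :
  cross_moment (fun omega => col_mx (X omega) (Y omega)) Z =
  col_mx (cross_moment X Z) (cross_moment Y Z).
Proof.
apply/matrixP => i j; case: (split_ordP i) => a ->.
- rewrite col_mxEu !mxE; congr (fine 'E_P[_]); apply/funext => omega /=.
  by rewrite /coord col_mxEu.
- rewrite col_mxEd !mxE; congr (fine 'E_P[_]); apply/funext => omega /=.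
  by rewrite /coord col_mxEd.
Qed.

Lemma cross_moment_col_mxr k l p (X : T -> 'cV[F]_k) (Y : T -> 'cV[F]_l)
    (Z : T -> 'cV[F]_p) :
  cross_moment Z (fun omega => col_mx (X omega) (Y omega)) =
  row_mx (cross_moment Z X) (cross_moment Z Y).
Proof.
by rewrite -cross_moment_tr cross_moment_col_mxl tr_col_mx !cross_moment_tr.
Qed.

Lemma second_moment_col_mx k l (X : T -> 'cV[F]_k) (Y : T -> 'cV[F]_l) :
  cross_moment X Y = 0 ->
  second_moment P (fun omega => col_mx (X omega) (Y omega)) =
  block_mx (second_moment P X) 0 0 (second_moment P Y).
Proof.
move=> XY0.
rewrite -[LHS]/(cross_moment _ _) cross_moment_col_mxl !cross_moment_col_mxr.
by rewrite -(cross_moment_tr X Y) XY0 trmx0.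
Qed.

Lemma second_moment_mulmx k l (D : 'M[F]_(l, k)) (X : T -> 'cV[F]_k) :
  finite_second_moment P X ->
  second_moment P (fun omega => D *m X omega) = D *m second_moment P X *m D^T.
Proof.
move=> hX; rewrite -[LHS]/(cross_moment _ _) cross_moment_mulmxl//; last first.
  exact: finite_second_moment_mulmx.
by rewrite cross_moment_mulmxr// mulmxA.
Qed.

Lemma second_momentD k (X Y : T -> 'cV[F]_k) :
  finite_second_moment P X -> finite_second_moment P Y ->
  cross_moment X Y = 0 ->
  second_moment P (fun omega => X omega + Y omega) =
  second_moment P X + second_moment P Y.
Proof.
move=> hX hY XY0; rewrite -[LHS]/(cross_moment _ _).
have hXY := finite_second_momentD hX hY.
rewrite cross_momentDl// !cross_momentDr//.
by rewrite -(cross_moment_tr X Y) XY0 trmx0 addr0 add0r.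
Qed.

(* The form as a sum of functions over a sequence, the shape in which linearity of
   the expectation is available. *)
Let qformE k (M : 'M[F]_k) (X : T -> 'cV[F]_k) :
  (fun omega => qform M (X omega)) =
  \sum_(f <- [seq M i.1 i.2 \o* (coord X i.2 \* coord X i.1)
               | i <- index_enum ('I_k * 'I_k)%type]) f.
Proof.
apply/funext => omega; rewrite big_map fct_sumE /qform mxE.
under eq_bigr do rewrite mxE mulr_suml.
rewrite exchange_big pair_big /=; apply: eq_bigr => -[i j] _ /=.
by rewrite /coord mxE; ring.
Qed.

Lemma qform_Lfun1 k (M : 'M[F]_k) (X : T -> 'cV[F]_k) :
  finite_second_moment P X -> (fun omega => qform M (X omega)) \in Lfun P 1.
Proof.
move=> hX; rewrite qformE big_map; apply: rpred_sum => i _.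
by apply: Lfun_scale => //; exact: Lfun2_mul_Lfun1.
Qed.

(** A quadratic form is linear in the matrix X X^T, and x^T M x = tr (M x x^T). *)
Lemma expectation_qform k (M : 'M[F]_k) (X : T -> 'cV[F]_k) :
  finite_second_moment P X ->
  ('E_P[fun omega => qform M (X omega)] = (\tr (M *m second_moment P X))%:E)%E.
Proof.
move=> hX; rewrite qformE expectation_sum => [|f /mapP[i _ ->]]; last first.
  by apply: Lfun_scale => //; exact: Lfun2_mul_Lfun1.
rewrite big_map /mxtrace; under [in RHS]eq_bigr do rewrite mxE.
rewrite pair_big /= -sumEFin; apply: eq_bigr => -[i j] _ /=.
rewrite expectationZl ?Lfun2_mul_Lfun1// mxE EFinM fineK//.
exact: fin_num_cross.
Qed.

End SecondMoments.

(** * Independence and vanishing mixed moments *)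

(** The joint law of an independent pair is the product of the marginal laws,
    so Fubini splits the expectation of the product. *)
Lemma expectation_prod_independent (dT : measure_display)
    (T : measurableType dT) (F : realType) (P : probability T F)
    (f g : T -> F) :
  f \in Lfun P 2%:E -> g \in Lfun P 2%:E ->
  (forall S S', measurable S -> measurable S' ->
    P (f @^-1` S `&` g @^-1` S') = P (f @^-1` S) * P (g @^-1` S'))%E ->
  ('E_P[f \* g] = 'E_P[f] * 'E_P[g])%E.
Proof.
move=> f2 g2 indep.
have fg1 := Lfun2_mul_Lfun1 f2 g2.
have PT : P setT \is a fin_num by rewrite probability_setT.
have f1 : P.-integrable setT (EFin \o f).
  by apply/Lfun1_integrable/Lfun_subset12.
have g1 : P.-integrable setT (EFin \o g).
  by apply/Lfun1_integrable/Lfun_subset12.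
have mf : measurable_fun setT f by exact/measurable_EFinP/(measurable_int P).
have mg : measurable_fun setT g by exact/measurable_EFinP/(measurable_int P).
have mfg : measurable_fun setT (fun x => (f x, g x)) by exact: measurable_fun_pair.
pose X : {mfun T >-> F} := mfun_Sub (mem_set mf).
pose Y : {mfun T >-> F} := mfun_Sub (mem_set mg).
pose XY : {mfun T >-> (F * F)%type} := mfun_Sub (mem_set mfg).
pose h (z : F * F) : \bar F := (z.1 * z.2)%:E.
have mh : measurable_fun setT h.
  by apply/measurable_EFinP; exact: measurable_funM.
have hXY : P.-integrable setT (h \o XY) by exact/Lfun1_integrable.
have lawE (C : set (F * F)) : measurable C ->
    (distribution P X \x distribution P Y)%E C = distribution P XY C.
  by apply: product_measure_unique => S S' mS mS' /=; exact: indep.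
have ih : (distribution P X \x distribution P Y)%E.-integrable setT h.
  apply/integrableP; split=> //.
  rewrite (@eq_measure_integral _ _ _ _ (distribution P XY)) => [|C mC _].
    rewrite ge0_integral_distribution//; last exact: measurableT_comp.
    by have /integrableP[] := hXY.
  exact: lawE.
have Eg : ('E_P[g] = (fine 'E_P[g])%:E)%E.
  by rewrite fineK//; apply: expectation_fin_num; exact: (Lfun_subset12 PT).
transitivity (\int[distribution P XY]_z h z)%E.
  by rewrite unlock integral_distribution.
transitivity (\int[distribution P X \x distribution P Y]_z h z)%E.
  by apply: eq_measure_integral => C mC _; exact/esym/lawE.
rewrite -integral12_prod_meas1// /fubini_F.
transitivity (\int[distribution P X]_x (x%:E * 'E_P[g]))%E.
  apply: eq_integral => x _.
  transitivity (\int[distribution P Y]_y (x%:E * y%:E))%E.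
    by apply: eq_integral => y _; rewrite /h/= EFinM.
  rewrite integral_distribution//; last 2 first.
  - exact: measurable_funeM.
  - exact: integrableZl.
  by rewrite integralZl// unlock.
rewrite integral_distribution//.
- rewrite Eg integralZr//; congr (_ * _)%E; by rewrite unlock.
- by apply: emeasurable_funM.
- by rewrite Eg; apply: integrableZr.
Qed.

Section Uncorrelated.
Context {dT : measure_display} {T : measurableType dT} {F : realType}.
Variable P : probability T F.

(** Independence enters the quadratic costs only through this: against a centred
    vector, an independent one has vanishing mixed second moments. *)
Lemma cross_moment_independent k l (X : T -> 'cV[F]_k) (Y : T -> 'cV[F]_l) :
  finite_second_moment P X -> finite_second_moment P Y -> zero_mean P Y ->
  independent P X Y -> cross_moment P X Y = 0.
Proof.
move=> hX hY Y0 XY; apply/matrixP => i j; rewrite !mxE.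
rewrite expectation_prod_independent// ?Y0 ?mule0// => S S' mS mS'.
by apply: XY; apply: sub_gen_smallest; [exists i, S|exists j, S'].
Qed.

Lemma mutually_independent_pair (I : choiceType) (G : I -> set (set T)) i j :
  i != j -> mutually_independent P G ->
  forall E E', G i E -> G j E' -> (P (E `&` E') = P E * P E')%E.
Proof.
move=> ij indep E E' GE GE'.
pose f a := if a == i then E else E'.
have fi : f i = E by rewrite /f eqxx.
have fj : f j = E' by rewrite /f eq_sym (negbTE ij).
have := indep [fset i; j]%fset f.
rewrite big_fsetU1 ?inE//= big_seq_fset1 fi fj => <-; last first.
  by move=> a; rewrite !inE => /orP[] /eqP ->; rewrite ?fi ?fj.
congr (P _); rewrite -{1}fi -fj; apply/seteqP; split => omega /=.
  by move=> [Ei Ej] a /=; rewrite !inE => /orP[] /eqP ->.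
by move=> H; split; apply: H; rewrite /= !inE eqxx ?orbT.
Qed.

Lemma independent_col_mxl k l p (X : T -> 'cV[F]_k) (Y : T -> 'cV[F]_l)
    (Z : T -> 'cV[F]_p) :
  independent P (fun omega => col_mx (X omega) (Y omega)) Z ->
  independent P X Z /\ independent P Y Z.
Proof.
move=> XYZ; split=> E E' GE GE'; apply: XYZ => //; move: E GE;
  apply: sub_smallest2r; try exact: smallest_sigma_algebra.
- move=> _ [i [S [mS ->]]]; exists (lshift l i), S; split=> //.
  by congr (_ @^-1` S); apply/funext => omega; rewrite /coord col_mxEu.
- move=> _ [i [S [mS ->]]]; exists (rshift k i), S; split=> //.
  by congr (_ @^-1` S); apply/funext => omega; rewrite /coord col_mxEd.
Qed.

End Uncorrelated.

(** * Finiteness of Gaussian second moments *)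

Section GaussianMoments.
Context {F : realType}.

(** A second moment costs only a constant factor and a doubling of the variance,
    because y <= expR y absorbs the square into half of the exponent. *)
Lemma sqr_normal_fun_le (a s x : F) : s != 0 ->
  x ^+ 2 * normal_fun a s x <=
  (8 * s ^+ 2 + 2 * a ^+ 2) * normal_fun a (Num.sqrt 2 * s) x.
Proof.
move=> s0.
have s2 : 0 < s ^+ 2 by rewrite exprn_even_gt0.
(* The two normal kernels are exp (- 2 y) and exp (- y). *)
set y := (x - a) ^+ 2 / (4 * s ^+ 2).
have y0 : 0 <= y by rewrite divr_ge0 ?sqr_ge0// mulr_ge0// ltW.
have -> : normal_fun a (Num.sqrt 2 * s) x = expR (- y).
  rewrite /normal_fun exprMn sqr_sqrtr//; congr expR.
  by rewrite /y; field.
have -> : normal_fun a s x = expR (- y) * expR (- y).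
  rewrite /normal_fun -expRD; congr expR.
  by rewrite /y; field.
rewrite mulrA ler_pM2r ?expR_gt0// expRN ler_pdivrMr ?expR_gt0//.
have xa : (x - a) ^+ 2 = 4 * s ^+ 2 * y by rewrite /y; field.
have ey := expR_ge1Dx y.
have : x ^+ 2 <= 2 * (x - a) ^+ 2 + 2 * a ^+ 2.
  by have := sqr_ge0 (x - 2 * a); nra.
have a2 := sqr_ge0 a.
by rewrite xa; nra.
Qed.

(** The Radon-Nikodym derivative of the normal law agrees almost everywhere with
    its explicit density. *)
Lemma ge0_integral_normal_prob (a s : F) (f : F -> \bar F) :
  (forall x, 0 <= f x)%E -> measurable_fun setT f ->
  (\int[normal_prob a s]_x f x =
   \int[lebesgue_measure]_x (f x * (normal_pdf a s x)%:E))%E.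
Proof.
move=> f0 mf.
have dom := normal_prob_dominates a s.
have iRN := Radon_Nikodym_SigmaFinite.f_integrable dom.
have mpdf : measurable_fun setT (fun x : F => (normal_pdf a s x)%:E).
  by apply/measurable_EFinP; exact: measurable_normal_pdf.
rewrite -(Radon_Nikodym_SigmaFinite.change_of_variables dom)//.
apply: ae_eq_integral => //.
- by apply: emeasurable_funM => //; exact: (measurable_int _ iRN).
- exact: emeasurable_funM.
apply: ae_eqe_mul2l; apply: integral_ae_eq => // E _ mE.
by rewrite -Radon_Nikodym_SigmaFinite.f_integral.
Qed.

Lemma normal_second_moment_lty (a s : F) : s != 0 ->
  (\int[normal_prob a s]_x (x ^+ 2)%:E < +oo)%E.
Proof.
move=> s0; set s' := Num.sqrt 2 * s.
have s'0 : s' != 0 by rewrite mulf_neq0// gt_eqF// sqrtr_gt0.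
have p0 := normal_peak_gt0 s0; have p'0 := normal_peak_gt0 s'0.
set c := (8 * s ^+ 2 + 2 * a ^+ 2) * (normal_peak s / normal_peak s').
rewrite ge0_integral_normal_prob => [|x|]; last 2 first.
- by rewrite lee_fin sqr_ge0.
- by apply/measurable_EFinP; exact: measurable_funX.
apply: (@le_lt_trans _ _ (\int[lebesgue_measure]_x (c * normal_pdf a s' x)%:E)%E).
  apply: ge0_le_integral => //.
  - by move=> x _; rewrite lee_fin mulr_ge0 ?sqr_ge0 ?normal_pdf_ge0.
  - apply/measurable_EFinP; apply: measurable_funM.
      exact: measurable_funX.
    exact: measurable_normal_pdf.
  - by apply/measurable_EFinP; apply: measurable_funM => //;
      exact: measurable_normal_pdf.
  - move=> x _; rewrite lee_fin !normal_pdfE//.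
    rewrite [leLHS]mulrCA.
    have -> : c * (normal_peak s' * normal_fun a s' x) =
        normal_peak s * ((8 * s ^+ 2 + 2 * a ^+ 2) * normal_fun a s' x).
      by rewrite /c; field; rewrite gt_eqF.
    by rewrite ler_pM2l// sqr_normal_fun_le.
under eq_integral do rewrite EFinM.
rewrite integralZl//; last exact: integrable_normal_pdf.
by rewrite integral_normal_pdf mule1 ltry.
Qed.

Context {dT : measure_display} {T : measurableType dT}.
Variable P : probability T F.

Lemma Lfun2_sqr (f : T -> F) : measurable_fun setT f ->
  (\int[P]_x (f x ^+ 2)%:E < +oo)%E -> f \in Lfun P 2%:E.
Proof.
move=> mf foo; rewrite inE/=; apply/andP; split; rewrite inE//=.
rewrite /finite_norm unlock poweR_lty//.
by under eq_integral do rewrite /= powR_mulrn// -normrX ger0_norm ?sqr_ge0//.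
Qed.

(** [second_moment] is read through [fine], so prescribing its value does not
    exclude an infinite moment; the law of each coordinate, a point mass or a normal
    distribution, does. *)
Lemma gaussian_finite_second_moment k (X : T -> 'cV[F]_k) :
  gaussian_vector P X -> finite_second_moment P X.
Proof.
move=> [mX gX] i; apply: Lfun2_sqr; first exact: mX.
have [a [s law]] := gX (delta_mx i 0).
(* The normal law is a measure on the structure [measurableTypeR F], which has the
   same measurable sets as the default structure of F but another display. *)
have mXi : measurable_fun setT (coord X i : T -> measurableTypeR F).
  by move=> _ S mS; exact: mX.
pose Z : {mfun T >-> measurableTypeR F} :=
  @mfun_Sub _ _ T (measurableTypeR F) (coord X i) (mem_set mXi).
have {}law (S : set (measurableTypeR F)) : measurable S ->
    distribution P Z S = normal_law a s S.
  move=> mS; rewrite -law//; congr (P _); apply/funext => omega /=.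
  by rewrite trmx_delta -rowE mxE.
have m2 : measurable_fun setT (fun x : measurableTypeR F => (x ^+ 2)%:E).
  by apply/measurable_EFinP; exact: measurable_funX.
have -> : (\int[P]_x (coord X i x ^+ 2)%:E =
           \int[distribution P Z]_x (x ^+ 2)%:E)%E.
  by rewrite ge0_integral_distribution// => x; rewrite lee_fin sqr_ge0.
move: law; rewrite /normal_law; have [_|s0] := eqVneq s 0 => law.
  have -> : (\int[distribution P Z]_x (x ^+ 2)%:E =
             \int[dirac (a : measurableTypeR F)]_x (x ^+ 2)%:E)%E.
    by apply: eq_measure_integral => S mS _; exact: law.
  by rewrite integral_dirac// diracT mul1e ltry.
have -> : (\int[distribution P Z]_x (x ^+ 2)%:E =
           \int[normal_prob a s]_x (x ^+ 2)%:E)%E.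
  by apply: eq_measure_integral => S mS _; exact: law.
exact: normal_second_moment_lty.
Qed.

End GaussianMoments.

(** * Second moments of a linear system driven by white noise *)

Section LinearSystem.
Context {dT : measure_display} {T : measurableType dT} {F : realType}.
Variable P : probability T F.
Context {k : nat}.
Variables (A : 'M[F]_k) (Z E : nat -> T -> 'cV[F]_k).
Hypothesis ZS : forall t, Z t.+1 = fun omega => A *m Z t omega + E t omega.
Hypothesis Z0L2 : finite_second_moment P (Z 0%N).
Hypothesis EL2 : forall t, finite_second_moment P (E t).

Lemma state_finite_second_moment t : finite_second_moment P (Z t).
Proof.
elim: t => [//|t IH]; rewrite ZS.
by apply: finite_second_momentD => //; exact: finite_second_moment_mulmx.
Qed.

Hypothesis Z0E : forall t, cross_moment P (Z 0%N) (E t) = 0.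
Hypothesis EE : forall t u, t != u -> cross_moment P (E t) (E u) = 0.

(** The state at time t is built from the initial state and from disturbances
    strictly before t, hence the inequality. *)
Lemma state_uncorrelated t u : (t <= u)%N -> cross_moment P (Z t) (E u) = 0.
Proof.
elim: t => [//|t IH] tu; rewrite ZS.
have hZ := state_finite_second_moment t.
rewrite cross_momentDl//; last exact: finite_second_moment_mulmx.
rewrite cross_moment_mulmxl// IH ?mulmx0 ?add0r; last exact: ltnW.
by apply: EE; rewrite neq_ltn tu.
Qed.

Variable X : 'M[F]_k.
Hypothesis EX : forall t, second_moment P (E t) = X.

(** Solution of S_(t+1) = A S_t A^T + X; the cross terms of the recursion vanish by
    [state_uncorrelated]. *)
Lemma state_second_moment t :
  second_moment P (Z t) =
  A ^+ t *m second_moment P (Z 0%N) *m (A ^+ t)^T +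
  \sum_(i < t) A ^+ i *m X *m (A ^+ i)^T.
Proof.
elim: t => [|t IH].
  by rewrite big_ord0 addr0 expr0 -[1]/(1%:M) trmx1 mul1mx mulmx1.
rewrite ZS; have hZ := state_finite_second_moment t.
have hAZ := finite_second_moment_mulmx A hZ.
rewrite second_momentD//; last first.
  by rewrite cross_moment_mulmxl// state_uncorrelated// mulmx0.
have conjS (M : 'M[F]_k) i :
    A ^+ i.+1 *m M *m (A ^+ i.+1)^T = A *m (A ^+ i *m M *m (A ^+ i)^T) *m A^T.
  by rewrite exprS -[_ * _]/(_ *m _) trmx_mul !mulmxA.
rewrite second_moment_mulmx// EX IH mulmxDr mulmxDl -conjS -addrA; congr (_ + _).
rewrite big_ord_recl expr0 -[1]/(1%:M) trmx1 mul1mx mulmx1 addrC.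
congr (_ + _); rewrite mulmx_sumr mulmx_suml; apply: eq_bigr => i _.
by rewrite -conjS.
Qed.

End LinearSystem.

(** The averaged sequence converges, because the transient a tends to 0, so Cesaro
    applies to it; the case N = 0 does not matter for the limit. *)
Lemma cvg_mean_partial_sums (F : realType) (a c : nat -> F) :
  a @ \oo --> (0 : F) -> cvgn (series c) ->
  (fun N => N%:R^-1 * \sum_(t < N) (a t + \sum_(i < t) c i)) @ \oo -->
    limn (series c).
Proof.
move=> a0 cc.
have seriesE (u : nat -> F) N : series u N = \sum_(t < N) u t.
  by rewrite -(big_mkord xpredT).
have : (fun t => a t + series c t) @ \oo --> limn (series c).
  by rewrite -[X in _ --> X]add0r; exact: cvgD.
move=> /cesaro mean_cvg; rewrite -cvg_shiftS.
apply: cvg_trans mean_cvg; apply: near_eq_cvg.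
apply: nearW => N /=; rewrite /arithmetic_mean /=; congr (_ * _).
by rewrite seriesE; apply: eq_bigr => t _; rewrite seriesE.
Qed.

(** * The two costs *)

Section Controllers.
Context {F : realType} {n m d : nat}.
Variables (A : 'M[F]_n) (B : 'M[F]_(n, m)) (C : 'M[F]_(d, n)).
Variables (Q : 'M[F]_n) (R : 'M[F]_m).
Implicit Types K : 'M[F]_(m + n, d + n).

Definition stage_weight K : 'M[F]_(n + n) :=
  block_mx Q 0 0 ((ctrlC K)^T *m R *m ctrlC K).

Definition closed_loop_state K w v x0 xi0 t : 'cV[F]_(n + n) :=
  let z := trajectory A B C K w v x0 xi0 t in col_mx z.1 z.2.

Lemma stage_costE K z :
  stage_cost Q R K z = qform (stage_weight K) (col_mx z.1 z.2).
Proof.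
rewrite /stage_cost /qform tr_col_mx mul_row_block !mulmx0 addr0 add0r.
by rewrite mul_row_col [RHS]mxE trmx_mul !mulmxA.
Qed.

Lemma stage_cost_ge0 K z : sym_psd Q -> sym_pd R -> 0 <= stage_cost Q R K z.
Proof.
move=> [_ Q0] [_ R0]; rewrite addr_ge0//.
have [->|] := eqVneq (ctrlC K *m z.2) 0; last by move=> /R0/ltW.
by rewrite /qform mulmx0 mxE.
Qed.

Lemma closed_loop_stateS K w v x0 xi0 t :
  closed_loop_state K w v x0 xi0 t.+1 =
  closed_loop A B C K *m closed_loop_state K w v x0 xi0 t +
  col_mx (w t) (ctrlB K *m v t).
Proof.
rewrite /closed_loop_state /=.
case: (trajectory A B C K w v x0 xi0 t) => x xi /=.
rewrite mul_block_col add_col_mx mulmxDr !mulmxA; congr col_mx.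
by rewrite addrA (addrC (ctrlA K *m xi)).
Qed.

Lemma closed_loop_state_free K x0 xi0 t :
  closed_loop_state K (fun=> 0) (fun=> 0) x0 xi0 t =
  closed_loop A B C K ^+ t *m col_mx x0 xi0.
Proof.
elim: t => [|t IH]; first by rewrite expr0 -[1]/(1%:M) mul1mx.
rewrite closed_loop_stateS IH mulmx0 col_mx0 addr0 mulmxA.
by rewrite exprS.
Qed.

(** Expected stage cost at time t of the noise-free loop started from a random
    joint state with second moment the block-diagonal matrix of X11 and
    B_K V B_K^T. *)
Definition cost_term K (X11 : 'M[F]_n) (V : 'M[F]_d) t : F :=
  let L := closed_loop A B C K in
  \tr (stage_weight K *m
    (L ^+ t *m block_mx X11 0 0 (ctrlB K *m V *m (ctrlB K)^T) *m (L ^+ t)^T)).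

(** The free evolution is L^t z0; nonnegativity of the stage costs exchanges the
    expectation with the infinite sum. *)
Lemma dlqr_costE dT (T : measurableType dT) (P : probability T F)
    (x0 : T -> 'cV[F]_n) (s : T -> 'cV[F]_d) K :
  sym_psd Q -> sym_pd R ->
  finite_second_moment P x0 -> finite_second_moment P s -> zero_mean P s ->
  independent P x0 s -> stabilizing A B C K ->
  dlqr_cost A B C Q R P x0 s K =
  (limn (series (cost_term K (second_moment P x0) (second_moment P s))))%:E.
Proof.
move=> hQ hR hx0 hs s0 x0s [_ K1].
have hBs := finite_second_moment_mulmx (ctrlB K) hs.
pose z t (omega : T) :=
  closed_loop A B C K ^+ t *m col_mx (x0 omega) (ctrlB K *m s omega).
have hz0 := finite_second_moment_col_mx hx0 hBs.
have hz t : finite_second_moment P (z t) by exact: finite_second_moment_mulmx.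
have stageE t omega : stage_cost Q R K (trajectory A B C K (fun=> 0) (fun=> 0)
    (x0 omega) (ctrlB K *m s omega) t) = qform (stage_weight K) (z t omega).
  by rewrite stage_costE /z -closed_loop_state_free.
rewrite /dlqr_cost integral_nneseries//; last 2 first.
- move=> t; under eq_fun do rewrite stageE.
  exact: (measurable_int P (proj1 (Lfun1_integrable _ _) (qform_Lfun1 _ (hz t)))).
- by move=> t omega _; rewrite lee_fin stage_cost_ge0.
under eq_eseriesr => t _.
  under eq_integral do rewrite stageE.
  have := expectation_qform (stage_weight K) (hz t); rewrite unlock => ->.
  rewrite second_moment_mulmx// second_moment_col_mx; last first.
    by rewrite cross_moment_mulmxr// cross_moment_independent// mul0mx.
  rewrite second_moment_mulmx// -/(cost_term _ _ _ _).
  over.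
apply/cvg_lim => //.
rewrite (_ : (fun N => _) = EFin \o series
    (cost_term K (second_moment P x0) (second_moment P s))); last first.
  by apply/funext => N /=; rewrite sumEFin.
by apply: cvg_EFin; [exact: nearW|exact: is_cvg_series_trace_powers].
Qed.

(** The covariance of the state accumulates one [cost_term] per elapsed step, so
    the running average is a mean of partial sums plus a transient left by the
    initial states. *)
Lemma lqg_costE dT (T : measurableType dT) (P : probability T F)
    (x0 xi0 : T -> 'cV[F]_n) (w : nat -> T -> 'cV[F]_n)
    (v : nat -> T -> 'cV[F]_d) (W : 'M[F]_n) (Vn : 'M[F]_d) K :
  finite_second_moment P x0 -> finite_second_moment P xi0 ->
  gaussian_noise P w W -> gaussian_noise P v Vn ->
  noises_and_init_independent P x0 xi0 w v -> stabilizing A B C K ->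
  lqg_cost A B C Q R P x0 xi0 w v K = (limn (series (cost_term K W Vn)))%:E.
Proof.
move=> hx0 hxi0 hw hv hind [_ K1].
have wL2 t : finite_second_moment P (w t).
  by have [/gaussian_finite_second_moment] := hw t.
have vL2 t : finite_second_moment P (v t).
  by have [/gaussian_finite_second_moment] := hv t.
have w0 t : zero_mean P (w t) by have [] := hw t.
have v0 t : zero_mean P (v t) by have [] := hv t.
have BvL2 t := finite_second_moment_mulmx (ctrlB K) (vL2 t).
have pair i j ij := mutually_independent_pair (i := i) (j := j) ij hind.
have wv t u : cross_moment P (w t) (v u) = 0.
  by apply: cross_moment_independent => //;
    exact: (pair (Some (inl t)) (Some (inr u))).
have ww t u : t != u -> cross_moment P (w t) (w u) = 0.
  by move=> tu; apply: cross_moment_independent => //;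
    exact: (pair (Some (inl t)) (Some (inl u))).
have vv t u : t != u -> cross_moment P (v t) (v u) = 0.
  by move=> tu; apply: cross_moment_independent => //;
    exact: (pair (Some (inr t)) (Some (inr u))).
have vw t u : cross_moment P (v t) (w u) = 0.
  by rewrite -cross_moment_tr wv trmx0.
have [x0w xi0w] : (forall t, cross_moment P x0 (w t) = 0) /\
                  (forall t, cross_moment P xi0 (w t) = 0).
  by split=> t; have [? ?] := independent_col_mxl
    (pair None (Some (inl t)) isT); exact: cross_moment_independent.
have [x0v xi0v] : (forall t, cross_moment P x0 (v t) = 0) /\
                  (forall t, cross_moment P xi0 (v t) = 0).
  by split=> t; have [? ?] := independent_col_mxl
    (pair None (Some (inr t)) isT); exact: cross_moment_independent.
pose E t (omega : T) := col_mx (w t omega) (ctrlB K *m v t omega).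
pose Z t (omega : T) :=
  closed_loop_state K (w^~ omega) (v^~ omega) (x0 omega) (xi0 omega) t.
have EL2 t : finite_second_moment P (E t).
  exact: finite_second_moment_col_mx.
have Z0L2 : finite_second_moment P (Z 0%N).
  exact: finite_second_moment_col_mx.
have ZS t : Z t.+1 = fun omega => closed_loop A B C K *m Z t omega + E t omega.
  by apply/funext => omega; exact: closed_loop_stateS.
have Z0E t : cross_moment P (Z 0%N) (E t) = 0.
  rewrite cross_moment_col_mxl !cross_moment_col_mxr !cross_moment_mulmxr//.
  by rewrite x0w xi0w x0v xi0v !mul0mx row_mx0 col_mx0.
have EE t u : t != u -> cross_moment P (E t) (E u) = 0.
  move=> tu; rewrite cross_moment_col_mxl !cross_moment_col_mxr.
  rewrite !cross_moment_mulmxr// !cross_moment_mulmxl// ww// wv vw vv//.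
  by rewrite !mulmx0 !mul0mx row_mx0 col_mx0.
have EX t : second_moment P (E t) =
    block_mx W 0 0 (ctrlB K *m Vn *m (ctrlB K)^T).
  rewrite second_moment_col_mx; last by rewrite cross_moment_mulmxr// wv mul0mx.
  by rewrite second_moment_mulmx//; have [_ _ ->] := hw t; have [_ _ ->] := hv t.
have ZL2 := state_finite_second_moment ZS Z0L2 EL2.
pose L := closed_loop A B C K.
pose a t := \tr (stage_weight K *m
  (L ^+ t *m second_moment P (Z 0%N) *m (L ^+ t)^T)).
have stageE t : ('E_P[fun omega => qform (stage_weight K) (Z t omega)] =
    (a t + \sum_(i < t) cost_term K W Vn i)%:E)%E.
  rewrite expectation_qform// (state_second_moment ZS Z0L2 EL2 Z0E EE EX).
  by rewrite mulmxDr mxtraceD mulmx_sumr raddf_sum.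
rewrite /lqg_cost; apply/cvg_lim => //.
rewrite (_ : (fun N => _) = EFin \o (fun N => N%:R^-1 *
    \sum_(t < N) (a t + \sum_(i < t) cost_term K W Vn i))); last first.
  apply/funext => N /=; rewrite EFinM; congr (_ * _)%E.
  transitivity ('E_P[\sum_(f <- [seq (fun omega => qform (stage_weight K)
      (Z (val i) omega)) | i <- index_enum 'I_N]) f])%E.
    congr ('E_P[_])%E; apply/funext => omega.
    by rewrite big_map fct_sumE; apply: eq_bigr => t _; rewrite stage_costE.
  rewrite expectation_sum => [|f /mapP[t _ ->]]; last exact: qform_Lfun1.
  by rewrite big_map -sumEFin; apply: eq_bigr => t _; rewrite stageE.
apply: cvg_EFin; first exact: nearW.
apply: cvg_mean_partial_sums; last exact: is_cvg_series_trace_powers.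
exact/cvg_series_cvg_0/is_cvg_series_trace_powers.
Qed.

End Controllers.

Theorem proposition5 (F : realType) (n m d : nat)
  (A : 'M[F]_n) (B : 'M[F]_(n, m)) (C : 'M[F]_(d, n))
  (Q : 'M[F]_n) (R : 'M[F]_m) (hQ : sym_psd Q) (hR : sym_pd R)
  (* Problem (a): dLQR with structured initial controller state *)
  (da : measure_display) (Ta : measurableType da) (Pa : probability Ta F)
  (x0 : Ta -> 'cV[F]_n) (s : Ta -> 'cV[F]_d)
  (hx0 : finite_second_moment Pa x0) (hs : finite_second_moment Pa s)
  (hs0 : zero_mean Pa s) (hx0s : independent Pa x0 s)
  (X11 : 'M[F]_n) (V : 'M[F]_d)
  (hX11 : X11 = second_moment Pa x0) (hV : V = second_moment Pa s)
  (* Problem (b): LQG *)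
  (db : measure_display) (Tb : measurableType db) (Pb : probability Tb F)
  (x0' xi0' : Tb -> 'cV[F]_n)
  (w : nat -> Tb -> 'cV[F]_n) (v : nat -> Tb -> 'cV[F]_d)
  (W : 'M[F]_n) (Vn : 'M[F]_d)
  (hx0' : finite_second_moment Pb x0') (hxi0' : finite_second_moment Pb xi0')
  (hw : gaussian_noise Pb w W) (hv : gaussian_noise Pb v Vn)
  (hind : noises_and_init_independent Pb x0' xi0' w v)
  (* matching second moments *)
  (hXW : X11 = W) (hVV : V = Vn) :
  optimal_solutions A B C (dlqr_cost A B C Q R Pa x0 s) =
  optimal_solutions A B C (lqg_cost A B C Q R Pb x0' xi0' w v).
Proof.
have costE K : stabilizing A B C K ->
    dlqr_cost A B C Q R Pa x0 s K = lqg_cost A B C Q R Pb x0' xi0' w v K.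
  by move=> hK; rewrite dlqr_costE// (lqg_costE _ _ hx0' hxi0' hw hv hind hK)
    -hXW -hVV hX11 hV.
apply/seteqP; split=> K [hK Kopt]; (split; first exact: hK) => K' hK'.
- by rewrite -(costE K hK) -(costE K' hK'); exact: Kopt.
- by rewrite (costE K hK) (costE K' hK'); exact: Kopt.
Qed.
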